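(* Let $A$ be a Dedekind domain equipped with the trivial norm $|\cdot|_0$, let $n\ge1$, and let $X=\mathbf{A}^n_A$ be affine $n$-space over $A$, with analytification $\lambda\colon X^{\mathrm{An}}\to\mathcal{M}(A)$ over $(A,|\cdot|_0)$. Then the inclusion $\lambda^{-1}(|\cdot|_0)\hookrightarrow X^{\mathrm{An}}$ of the fibre over the trivial norm is a homotopy equivalence.
   Context: $|\cdot|_0$ denotes the trivial norm ($|0|_0=0$, $|a|_0=1$ for $a\neq0$). A multiplicative seminorm on a ring $B$ is a map $|\cdot|\colon B\to\mathbf{R}_{\ge 0}$ with $|0|=0$, $|1|=1$, $|fg|=|f||g|$, $|f+g|\le |f|+|g|$. $\mathcal{M}(A)$ is the set of multiplicative seminorms on $A$ bounded above by $|\cdot|_0$, with the topology of pointwise convergence. $X^{\mathrm{An}}$ is the set of multiplicative seminorms $x$ on $A[T_1,\dots,T_n]$ (write $|f(x)|$ for the value of $x$ at $f$) such that $|a(x)|\le|a|_0$ for all $a\in A$, with the coarsest topology making $x\mapsto|f(x)|$ continuous for every $f\in A[T_1,\dots,T_n]$. The map $\lambda$ restricts seminorms to $A$. *)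

(* Defs.v *)
From mathcomp Require Import all_boot all_order all_algebra.
From mathcomp Require Import fraction ring_quotient.
From mathcomp Require Import -(notations) mpoly.
From mathcomp Require Import all_classical reals topology normedtype.
Import Order.TTheory GRing.Theory Num.Theory.
Import numFieldNormedType.Exports.

Set Implicit Arguments.
Unset Strict Implicit.
Unset Printing Implicit Defensive.

Local Open Scope classical_set_scope.
Local Open Scope ring_scope.

(* The notations of mpoly clash with those of the analysis library, so they
   are left out of the import; the only one needed is restated here. *)
Notation "{ 'mpoly' A [ n ] }" := (mpoly n A)
  (at level 0, A at level 2, n at level 2, format "{ 'mpoly'  A [ n ] }")
  : type_scope.

Section Dedekind.
Variable A : idomainType.

(* [idealr_closed] describes the proper ideals; the unit ideal is always
   finitely generated, so it need not be considered. *)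
Definition noetherian : Prop :=
  forall I : {pred A}, idealr_closed I ->
    exists s : seq A, {subset s <= I} /\
      forall x, x \in I ->
        exists c : 'I_(size s) -> A, x = \sum_(i < size s) c i * s`_i.

Definition integrally_closed : Prop :=
  forall z : {fraction A}, integralOver (@FracField.tofrac A) z ->
    exists a : A, z = FracField.tofrac a.

Definition maximal_ideal (P : {pred A}) : Prop :=
  idealr_closed P /\
  forall I : {pred A}, idealr_closed I -> {subset P <= I} -> {subset I <= P}.

Definition dim_le1 : Prop :=
  forall P : {pred A}, idealr_closed P -> prime_idealr_closed P ->
    (exists2 a, a \in P & a != 0) -> maximal_ideal P.

(* Fields are allowed. *)
Definition dedekind_domain : Prop :=
  [/\ noetherian, integrally_closed & dim_le1].

End Dedekind.

Section Homotopy.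
Variable R : realType.

(* Only the values of [H] on X x [0, 1] matter. *)
Definition homotopic (X Y : topologicalType) (f g : X -> Y) : Prop :=
  exists H : X * R -> Y,
    [/\ {within [set: X] `*` `[0, 1], continuous H},
        forall x, H (x, 0) = f x & forall x, H (x, 1) = g x].

Definition homotopy_equivalence (X Y : topologicalType) (f : X -> Y) : Prop :=
  continuous f /\
  exists g : Y -> X,
    [/\ continuous g, homotopic (g \o f) id & homotopic (f \o g) id].

End Homotopy.

Definition mul_seminorm (R : realType) (B : nzRingType) (x : B -> R) : Prop :=
  [/\ forall f, 0 <= x f, x 0 = 0, x 1 = 1,
      forall f g, x (f * g) = x f * x g &
      forall f g, x (f + g) <= x f + x g].

Definition trivial_norm (R : realType) (A : idomainType) (a : A) : R := (a != 0)%:R.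
Arguments trivial_norm : clear implicits.

Lemma mul_seminorm_trivial_norm (R : realType) (A : idomainType) :
  mul_seminorm (trivial_norm R A).
Proof.
rewrite /trivial_norm; split => [f|||f g|f g].
- by rewrite ler0n.
- by rewrite eqxx.
- by rewrite oner_eq0.
- by rewrite mulf_eq0 negb_or -natrM mulnb.
- rewrite -natrD ler_nat; case: (eqVneq f 0) => [->|_].
    by rewrite add0r add0n.
  exact: leq_trans (leq_b1 _) (leq_addr _ _).
Qed.

(* As subsets of a space of functions with the topology of pointwise
   convergence, M(A) and X^An below carry, as types, the coarsest topology
   making all the evaluations continuous. *)
Definition spectrum (R : realType) (A : idomainType) : set {ptws A -> R} :=
  [set x | mul_seminorm (x : A -> R) /\ forall a, x a <= trivial_norm R A a].
Arguments spectrum : clear implicits.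

Definition analytic_affine_space (R : realType) (A : idomainType) (n : nat) :
    set {ptws {mpoly A[n]} -> R} :=
  [set x | mul_seminorm (x : {mpoly A[n]} -> R) /\
           forall a : A, x (mpolyC n a) <= trivial_norm R A a].
Arguments analytic_affine_space : clear implicits.

Lemma trivial_norm_in_spectrum (R : realType) (A : idomainType) :
  (trivial_norm R A : {ptws A -> R}) \in spectrum R A.
Proof. by apply/mem_set; split => //; exact: mul_seminorm_trivial_norm. Qed.

Definition trivial_point (R : realType) (A : idomainType) : spectrum R A :=
  exist _ (trivial_norm R A) (trivial_norm_in_spectrum R A).

Lemma restriction_in_spectrum (R : realType) (A : idomainType) (n : nat)
    (x : analytic_affine_space R A n) :
  (fun a => \val x (mpolyC n a)) \in spectrum R A.
Proof.
have /set_mem [[x_ge0 x0 x1 xM xD] x_le] := valP x.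
apply/mem_set; split => //; split => [a|||a b|a b].
- exact: x_ge0.
- by rewrite mpolyC0.
- by rewrite mpolyC1.
- by rewrite mpolyCM.
- by rewrite mpolyCD.
Qed.

Definition lambda (R : realType) (A : idomainType) (n : nat)
    (x : analytic_affine_space R A n) : spectrum R A :=
  exist _ (fun a => \val x (mpolyC n a)) (restriction_in_spectrum x).

Definition trivial_fibre (R : realType) (A : idomainType) (n : nat) :
    set (analytic_affine_space R A n) :=
  @lambda R A n @^-1` [set trivial_point R A].
Arguments trivial_fibre : clear implicits.

(* Main.v *)
From HB Require Import structures.
Require Import Defs.
From mathcomp Require Import all_boot all_order all_algebra.
From mathcomp Require Import fraction ring_quotient ring lra.
From mathcomp Require Import -(notations) mpoly.
From mathcomp Require Import all_classical reals topology normedtype.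
Import Order.TTheory GRing.Theory Num.Theory.
Import numFieldNormedType.Exports.

(** Both the analytification and the fibre over the trivial norm are
    contractible, so the inclusion is a homotopy equivalence whose inverse is a
    constant map.

    The contraction has two stages.  The first one uses only that points are
    ultrametric seminorms ([mul_seminorm_ultrametric]).  For a point [x] and a
    polynomial [f], the function [c |-> f (c T)] is a polynomial in one
    variable [c] over [A[T_1, .., T_n]], and its Gauss norm, relative to [x],
    on any disc of the [c]-line is again a multiplicative seminorm by the Gauss
    lemma ([gaussM]).  Discs centred at [1] with radius growing from [0] to [1],
    followed by discs centred at [0] with radius decreasing from [1] to [0],
    join the point [1] to the point [0]; this works without a break because
    the unit disc is centred at both ([gauss_translate]).  Hence [x] is joined
    to the seminorm [f |-> x (f (0))], continuously in [x] and without leaving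
    the fibre of [x] over the spectrum ([contraction_to_zero_section]).  On the
    fibre over the trivial norm, this is already a contraction.

    The second stage contracts the zero section, a copy of the spectrum of [A].
    For a Dedekind domain the localization at a prime [p] has a uniformizer
    ([dedekind_uniformizer]), so a point [y] with centre [p = {y < 1}] has the
    form [r ^ ord_p] with [r] in [0, 1] ([spectrum_padic_norm]), and the flow
    replaces [r] by [max r q] with [q] going from [0] to [1].  It is
    continuous ([spectrum_flow_continuous]): away from the trivial norm the
    centre is locally constant, and at the trivial norm the flow is squeezed
    between [y] and [1]. *)

Set Implicit Arguments.
Unset Strict Implicit.
Unset Printing Implicit Defensive.

Local Open Scope classical_set_scope.
Local Open Scope ring_scope.

(** * Uniformizers of a Dedekind domain *)

Section Ideals.
Variable A : idomainType.
Implicit Types (p I J : {pred A}) (a b c d s u w : A).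

Lemma idealr_closedD I a b : idealr_closed I -> a \in I -> b \in I -> a + b \in I.
Proof. by case=> _ _ idI aI bI; rewrite -(mul1r a); exact: idI. Qed.

Lemma idealr_closedMl I a b : idealr_closed I -> b \in I -> a * b \in I.
Proof. by case=> I0 _ idI bI; rewrite -(addr0 (a * b)); exact: idI. Qed.

Lemma idealr_closed_sum I (n : nat) (F : 'I_n -> A) :
  idealr_closed I -> (forall i, F i \in I) -> \sum_(i < n) F i \in I.
Proof.
move=> idI FI; elim/big_rec: _ => [|i x _ xI]; first by case: idI.
exact: idealr_closedD.
Qed.

Lemma prime_idealM p a b : prime_idealr_closed p ->
  a \notin p -> b \notin p -> a * b \notin p.
Proof. by move=> pp ap bp; apply/negP => /pp; rewrite (negbTE ap) (negbTE bp). Qed.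

(** A family of proper ideals without maximal element contains a strictly
    ascending sequence; its union is finitely generated, hence equal to one of
    its terms. *)
Lemma noetherian_maximal (F : {pred A} -> Prop) : noetherian A ->
  (exists I, F I) -> (forall I, F I -> idealr_closed I) ->
  exists2 I, F I & forall J, F J -> {subset I <= J} -> {subset J <= I}.
Proof.
move=> noeA [I0 FI0] idF; apply: contrapT => nomax.
have /choice[next nextP] : forall I : {I | F I}, exists J : {I | F I},
    {subset sval I <= sval J} /\ ~ {subset sval J <= sval I}.
  case=> I FI; apply: contrapT => noJ; apply: nomax; exists I => // J FJ IJ.
  by apply: contrapT => JI; apply: noJ; exists (exist _ J FJ).
pose C k := sval (iter k next (exist _ I0 FI0)).
have idC k : idealr_closed (C k) by apply: idF; exact: svalP.
have leC k l : (k <= l)%N -> {subset C k <= C l}.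
  move=> /subnK <-; elim: (l - k)%N => [//|m IHm] a /IHm.
  by rewrite addSn; have [+ _] := nextP (iter (m + k) next (exist _ I0 FI0)); apply.
pose U : {pred A} := fun a => `[< exists k, a \in C k >].
have UP a : reflect (exists k, a \in C k) (a \in U) by exact: asboolP.
have idU : idealr_closed U.
  split; first by apply/UP; exists 0%N; case: (idC 0%N).
    by apply/UP => -[k]; case: (idC k) => _ /negP.
  move=> a u v /UP[k uk] /UP[l vl]; apply/UP; exists (maxn k l).
  apply: idealr_closedD => //; last by apply: leC vl; exact: leq_maxr.
  by apply: idealr_closedMl => //; apply: leC uk; exact: leq_maxl.
have [s [sU genU]] := noeA _ idU.
have [k sC] : exists k, {subset s <= C k}.
  elim: s sU {genU} => [|a s IHs] sU; first by exists 0%N.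
  have [|k sk] := IHs; first by move=> b bs; apply: sU; rewrite inE bs orbT.
  have /UP[l al] := sU a (mem_head a s); exists (maxn k l) => b.
  rewrite inE => /predU1P[->|/sk].
    by apply: leC al; exact: leq_maxr.
  by apply: leC; exact: leq_maxl.
have [_] := nextP (iter k next (exist _ I0 FI0)); apply => a aCk.
have /genU[c ->] : a \in U by apply/UP; exists k.+1.
apply: idealr_closed_sum (idC k) _ => i; apply: idealr_closedMl (idC k) _.
by apply: sC; exact: mem_nth.
Qed.

(** The contraction to [A] of the ideal [(b : c)] of the localization at
    [p]. *)
Definition loc_colon p b c : {pred A} :=
  fun u => `[< exists s w, s \notin p /\ s * u * c = w * b >].

Lemma loc_colonP p b c u :
  reflect (exists s w, s \notin p /\ s * u * c = w * b) (u \in loc_colon p b c).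
Proof. exact: asboolP. Qed.

Lemma loc_colon_ideal p b c : idealr_closed p -> prime_idealr_closed p ->
  1 \notin loc_colon p b c -> idealr_closed (loc_colon p b c).
Proof.
move=> [p0 p1 _] pp I1; split => //.
  by apply/loc_colonP; exists 1, 0; rewrite !(mulr0, mul0r).
move=> a u v /loc_colonP[s [w [sp su]]] /loc_colonP[t [z [tp tv]]].
apply/loc_colonP; exists (s * t), (t * a * w + s * z).
split; first exact: prime_idealM.
transitivity (t * a * (s * u * c) + s * (t * v * c)); first by ring.
by rewrite su tv; ring.
Qed.

Lemma loc_colon_sub p b c : prime_idealr_closed p ->
  1 \notin loc_colon p b c -> {subset loc_colon p b c <= p}.
Proof.
move=> pp I1 u /loc_colonP[s [w [sp su]]]; apply: contrapT => /negP up.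
move/negP: I1; apply; apply/loc_colonP; exists (s * u), w.
by rewrite mulr1; split => //; exact: prime_idealM.
Qed.

(** Denominators of finitely many fractions have a common multiple. *)
Lemma common_denominator p b c (r : seq A) :
  idealr_closed p -> prime_idealr_closed p -> {subset r <= loc_colon p b c} ->
  exists2 d, d \notin p & forall a, a \in r -> exists w, a * (d * c) = w * b.
Proof.
move=> [_ p1 _] pp; elim: r => [|a r IHr] sr; first by exists 1.
have [|d dp dr] := IHr; first by move=> x xr; apply: sr; rewrite inE xr orbT.
have /loc_colonP[s [w [sp sac]]] := sr a (mem_head a r).
exists (d * s) => [|x]; first exact: prime_idealM.
rewrite inE => /predU1P[->|/dr[z xz]].
  by exists (d * w); rewrite -[RHS]mulrA -sac; ring.
by exists (s * z); rewrite -[RHS]mulrA -xz; ring.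
Qed.

(** If multiplication by the fraction [c / b] maps the ideal generated by [r]
    into itself, then [c / b] is an eigenvalue of a matrix over [A], hence
    integral over [A]. *)
Lemma stable_ideal_dvd b c (r : seq A) (M : 'I_(size r) -> 'I_(size r) -> A) :
  integrally_closed A -> b != 0 -> (exists i : 'I_(size r), r`_i != 0) ->
  (forall i : 'I_(size r), r`_i * c = (\sum_(j < size r) M i j * r`_j) * b) ->
  exists a, c = a * b.
Proof.
move=> icA b0 [i0 ri0] rM.
pose f := @FracField.tofrac A; pose z := f c / f b.
have fb0 : f b != 0 by rewrite tofrac_eq0.
pose N := \matrix_(i, j) M j i.
have : eigenvalue (map_mx f N) z.
  apply/eigenvalueP; exists (\row_i f r`_i); last first.
    apply/eqP => /rowP/(_ i0)/eqP; rewrite !mxE tofrac_eq0.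
    exact/negP.
  have zr (i : 'I_(size r)) : z * f r`_i = f (\sum_(j < size r) M i j * r`_j).
    apply: (mulIf fb0); rewrite -rmorphM -rM rmorphM.
    by rewrite mulrAC /z (divfK fb0) mulrC.
  apply/rowP => i; rewrite !mxE zr /f raddf_sum.
  by apply: eq_bigr => j _; rewrite !mxE /= rmorphM mulrC.
rewrite eigenvalue_root_char -map_char_poly => rootz.
have [|a za] := icA z; first by exists (char_poly N) => //; exact: char_poly_monic.
exists a; apply/eqP; rewrite -tofrac_eq /= tofracM -za /z.
by rewrite (divfK fb0).
Qed.

(** [uniformizer p x] says that [x] generates the maximal ideal of the
    localization at [p]; for [p = 0] the uniformizer is [0]. *)
Definition uniformizer p x :=
  x \in p /\ forall a, a \in p -> exists d w, d \notin p /\ d * a = w * x.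

(** Take a maximal element [(b : c)] among the proper ideals of this form of
    the localization, with [b] a fixed nonzero element of [p].  It is prime,
    hence it is the maximal ideal [p].  So [c / b] maps [p] into the local
    ring; it cannot map [p] into itself, because it would be integral. *)
Lemma dedekind_uniformizer p : dedekind_domain A ->
  idealr_closed p -> prime_idealr_closed p -> exists x, uniformizer p x.
Proof.
move=> [noeA icA dimA] idp pp; have [p0 p1 _] := idp.
have [[b bp b0]|pz] := pselect (exists2 b, b \in p & b != 0); last first.
  exists 0; split => // a ap; exists 1, 0; split => //.
  apply/eqP; rewrite mul1r mulr0; apply: contrapT => /negP a0.
  by apply: pz; exists a.
pose F I := exists2 c, I = loc_colon p b c & 1 \notin loc_colon p b c.
have [||_ [c -> c1] maxc] := @noetherian_maximal F noeA.
- exists (loc_colon p b 1), 1 => //; apply/loc_colonP => -[s [w [sp]]].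
  rewrite !mulr1 => sw; move/negP: sp; apply; rewrite sw.
  exact: idealr_closedMl.
- by move=> _ [c -> c1]; exact: loc_colon_ideal.
have subp := loc_colon_sub pp c1.
have idc := loc_colon_ideal idp pp c1.
have pc : prime_idealr_closed (loc_colon p b c).
  move=> u v /loc_colonP[s [w [sp suv]]]; apply/orP.
  have [vc|vNc] := boolP (v \in loc_colon p b c); [by right|left].
  apply: (maxc (loc_colon p b (c * v))).
  - exists (c * v) => //; apply: contraNN vNc => /loc_colonP[t [z [tp tcv]]].
    by apply/loc_colonP; exists t, z; split => //; rewrite -tcv; ring.
  - move=> x /loc_colonP[t [z [tp txc]]]; apply/loc_colonP; exists t, (z * v).
    by split=> //; rewrite mulrA txc; ring.
  - by apply/loc_colonP; exists s, w; split=> //; rewrite -suv; ring.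
have pcol : {subset p <= loc_colon p b c}.
  (* The ideal is maximal, because it is prime and contains [b]. *)
  have [|_ +] := dimA _ idc pc; last by apply.
  exists b => //; apply/loc_colonP; exists 1, c; split => //.
  by rewrite mul1r mulrC.
have [r [rp genp]] := noeA _ idp.
have [|d dp dr] := common_denominator (b := b) (c := c) idp pp (r := r).
  by move=> a /rp /pcol.
have dcb a : d * c <> a * b.
  move=> dca; move/negP: c1; apply; apply/loc_colonP; exists d, a.
  by rewrite mulr1.
have dpP a : a \in p -> exists w, a * (d * c) = w * b.
  move=> /genp[e ->].
  have /choice[w wP] (i : 'I_(size r)) : exists w, r`_i * (d * c) = w * b.
    by apply: dr; exact: mem_nth.
  exists (\sum_(i < size r) e i * w i); rewrite !mulr_suml.
  by apply: eq_bigr => i _; rewrite -mulrA wP mulrA.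
(* With [z = d c / b], either [z x] is a unit for some [x] in [p], which is then
   the uniformizer, or [z p] is contained in [p]. *)
have [[x [xp [w wp xw]]]|noint] := pselect
    (exists x, x \in p /\ exists2 w, w \notin p & x * (d * c) = w * b).
  exists x; split => // a ap; have [v av] := dpP a ap.
  exists w, v; split => //; apply: (mulIf b0).
  transitivity (a * (w * b)); first by ring.
  by rewrite -xw mulrCA av; ring.
have /choice[w wP] (i : 'I_(size r)) :
    exists w, r`_i * (d * c) = w * b /\ w \in p.
  have rip : r`_i \in p by apply: rp; exact: mem_nth.
  have [w wb] := dpP _ rip; exists w; split => //; apply: contrapT => /negP wp.
  by apply: noint; exists r`_i; split => //; exists w.
have /choice[M MP] (i : 'I_(size r)) := genp _ (wP i).2.
have [||a /dcb//] := @stable_ideal_dvd b (d * c) r M icA b0.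
  have [e be] := genp _ bp; apply: contrapT => r0; move/eqP: b0; apply.
  rewrite be big1 // => i _; have [->|ri] := eqVneq r`_i 0; first by rewrite mulr0.
  by exfalso; apply: r0; exists i.
by move=> i; rewrite -MP (wP i).1.
Qed.

(** In the localization at [p], [a] is a unit times the [k]-th power of [x]. *)
Definition has_order p x a k :=
  exists s u, [/\ s \notin p, u \notin p & s * a = u * x ^+ k].

End Ideals.

(** * The order of an element at a prime *)

Section Order.
Variables (A : idomainType) (p : {pred A}) (x : A).
Hypotheses (idp : idealr_closed p) (pp : prime_idealr_closed p).
Hypothesis xP : uniformizer p x.
Implicit Types (a b s u : A) (k l m : nat).

(** Krull: dividing [a] by the uniformizer as long as possible yields an
    ascending chain of ideals of the localization. *)
Lemma has_order_ex a : noetherian A -> a != 0 -> exists k, has_order p x a k.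
Proof.
move=> noeA a0; apply: contrapT => noa; have [p0 p1 _] := idp.
pose S b := b != 0 /\ ~ exists k, has_order p x b k.
have Sp b : S b -> b \in p.
  move=> [_ nob]; apply: contrapT => /negP bp; apply: nob; exists 0%N, 1, b.
  by rewrite mul1r mulr1.
pose F I := exists2 b, S b & I = loc_colon p b 1.
have [||_ [b Sb ->] maxb] := @noetherian_maximal A F noeA.
- by exists (loc_colon p a 1), a.
- move=> _ [b /Sp bp ->]; apply: loc_colon_ideal => //.
  apply/loc_colonP => -[s [w [sp]]]; rewrite !mulr1 => sw.
  by move/negP: sp; apply; rewrite sw; exact: idealr_closedMl.
have [d [b' [dp db]]] := xP.2 b (Sp b Sb); have [b0 nob] := Sb.
have d0 : d != 0 by apply: contraNneq dp => ->.
have Sb' : S b'.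
  split; first by apply: contraNneq (mulf_neq0 d0 b0) => b'0; rewrite db b'0 mul0r.
  move=> [k [s [u [sp up sb]]]]; apply: nob; exists k.+1, (s * d), u.
  split => //; first exact: prime_idealM.
  by rewrite -mulrA db mulrA sb exprSr mulrA.
have /loc_colonP[s [w [sp sb']]] : b' \in loc_colon p b 1.
  apply: (maxb (loc_colon p b' 1)); first by exists b'.
    move=> u /loc_colonP[s [w [sp su]]]; apply/loc_colonP; exists (d * s), (w * x).
    split; first exact: prime_idealM.
    transitivity (d * (s * u * 1)); first by ring.
    by rewrite su -mulrA (mulrC x) -db; ring.
  by apply/loc_colonP; exists 1, 1; rewrite !mul1r mulr1.
have b'0 : b' != 0 by case: Sb'.
have /negP := prime_idealM pp dp sp; apply.
suff -> : d * s = w * x by apply: idealr_closedMl => //; case: xP.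
apply: (mulIf b'0); transitivity (d * (s * b' * 1)); first by ring.
by rewrite sb' mulrCA db; ring.
Qed.

(** If [l < k], cancelling [x ^+ l] would exhibit a product of elements outside
    [p] as a multiple of [x], against the primality of [p]. *)
Lemma has_order_leq a b s w k l : s \notin p -> b != 0 -> s * b = w * a ->
  has_order p x a k -> has_order p x b l -> (k <= l)%N.
Proof.
move=> sp b0 sb [t [u [tp up ta]]] [t' [u' [t'p u'p t'b]]].
rewrite leqNgt; apply/negP => lk; have [p0 _ _] := idp.
have xl0 : x ^+ l != 0.
  have t'0 : t' != 0 by apply: contraNneq t'p => ->.
  by have := mulf_neq0 t'0 b0; rewrite t'b mulf_eq0 negb_or => /andP[].
have /negP := prime_idealM pp (prime_idealM pp sp tp) u'p; apply.
suff -> : s * t * u' = t' * w * u * x ^+ (k - l).-1 * x.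
  by apply: idealr_closedMl => //; case: xP.
apply: (mulIf xl0); transitivity (s * t * (u' * x ^+ l)); first by ring.
rewrite -t'b; transitivity (t' * t * (s * b)); first by ring.
rewrite sb; transitivity (t' * w * (t * a)); first by ring.
rewrite ta -[in LHS](subnK (ltnW lk)) exprD -[in LHS](@prednK (k - l)) ?subn_gt0 //.
by rewrite exprSr; ring.
Qed.

Lemma has_order_inj a k l : a != 0 ->
  has_order p x a k -> has_order p x a l -> k = l.
Proof.
move=> a0 ak al; have [_ p1 _] := idp; apply/eqP; rewrite eqn_leq.
by rewrite (@has_order_leq a a 1 1 k l) // (@has_order_leq a a 1 1 l k).
Qed.

Lemma has_orderM a b k l : has_order p x a k -> has_order p x b l ->
  has_order p x (a * b) (k + l).
Proof.
move=> [s [u [sp up sa]]] [t [v [tp vp tb]]]; exists (s * t), (u * v).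
split; [exact: prime_idealM|exact: prime_idealM|].
by rewrite mulrACA sa tb exprD mulrACA.
Qed.

Lemma has_orderD a b k l m : a + b != 0 -> (k <= l)%N ->
  has_order p x a k -> has_order p x b l -> has_order p x (a + b) m -> (k <= m)%N.
Proof.
move=> ab0 kl [s [u [sp up sa]]] [t [v [tp vp tb]]] abm; have [_ p1 _] := idp.
apply: (@has_order_leq (x ^+ k) (a + b) (s * t)
  (t * u + s * v * x ^+ (l - k))) abm => //; first exact: prime_idealM.
  transitivity (t * (s * a) + s * (t * b)); first by ring.
  by rewrite sa tb -[in LHS](subnK kl) exprD; ring.
by exists 1, 1; rewrite mul1r.
Qed.

Lemma has_order0 a : a \notin p -> has_order p x a 0.
Proof. by case: idp => _ p1 _ ap; exists 1, a; rewrite mul1r mulr1. Qed.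

End Order.

(** * Multiplicative seminorms bounded by 1 on integers are ultrametric *)

Section Ultrametric.
Variables (R : realType) (B : comNzRingType) (x : B -> R).
Implicit Types (f g : B) (k m : nat).

Definition ultrametric := forall f g, x (f + g) <= Num.max (x f) (x g).

Hypothesis xP : mul_seminorm x.

Lemma mul_seminorm_ge0 f : 0 <= x f. Proof. by case: xP. Qed.

Lemma mul_seminorm0 : x 0 = 0. Proof. by case: xP. Qed.

Lemma mul_seminorm1 : x 1 = 1. Proof. by case: xP. Qed.

Lemma mul_seminormM f g : x (f * g) = x f * x g. Proof. by case: xP. Qed.

Lemma mul_seminormX f k : x (f ^+ k) = x f ^+ k.
Proof.
elim: k => [|k IHk]; first by rewrite !expr0 mul_seminorm1.
by rewrite !exprS mul_seminormM IHk.
Qed.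

Lemma mul_seminormN f : x (- f) = x f.
Proof.
suff xN1 : x (-1) = 1 by rewrite -mulN1r mul_seminormM xN1 mul1r.
apply/eqP; rewrite -(@eqrXn2 _ 2) ?mul_seminorm_ge0 ?ler01 //.
by rewrite -mul_seminormX sqrrN expr1n mul_seminorm1 expr1n.
Qed.

Lemma mul_seminorm_sum (I : Type) (r : seq I) (P : pred I) (F : I -> B) :
  x (\sum_(i <- r | P i) F i) <= \sum_(i <- r | P i) x (F i).
Proof.
elim/big_ind2: _ => [|f a g b fa gb|//]; first by rewrite mul_seminorm0.
by case: xP => _ _ _ _ /(_ a b) /le_trans; apply; exact: lerD.
Qed.

End Ultrametric.

(** An exponential is not bounded by a linear function. *)
Lemma ler_of_exprn_linear (R : realType) (a b : R) : 0 <= a -> 0 <= b ->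
  (forall k, a ^+ k <= k.+1%:R * b ^+ k) -> a <= b.
Proof.
move=> a0 b0 ab; rewrite leNgt; apply/negP => ltba.
have [b_eq0|b_neq0] := eqVneq b 0.
  by have := ab 1%N; rewrite b_eq0 expr1 mulr0 leNgt -b_eq0 ltba.
have b_gt0 : 0 < b by rewrite lt_def b_neq0.
pose d := a / b - 1.
have d0 : 0 < d by rewrite subr_gt0 ltr_pdivlMr // mul1r.
have bern k : 1 + k%:R * d <= (1 + d) ^+ k.
  elim: k => [|k IHk]; first by rewrite mul0r addr0 expr0.
  rewrite exprS -natr1; have k0 : 0 <= k%:R :> R by exact: ler0n.
  have : (1 + d) * (1 + k%:R * d) <= (1 + d) * (1 + d) ^+ k.
    by apply: ler_wpM2l => //; lra.
  apply: le_trans; have : 0 <= k%:R * (d * d) by apply: mulr_ge0 => //; nra.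
  nra.
have bound k : (1 + d) ^+ k <= k.+1%:R.
  by rewrite addrC subrK expr_div_n ler_pdivrMr ?exprn_gt0.
(* The square of Bernoulli's inequality at [N] is quadratic in [N], and is
   compared with the linear bound at the exponent [2 N]. *)
have [N Nd] : exists N : nat, 2 < N%:R * d ^+ 2.
  exists (Num.truncn (2 / d ^+ 2)).+1.
  rewrite -ltr_pdivrMr ?exprn_gt0 //; exact: truncnS_gt.
have := bound (2 * N)%N; rewrite mulnC exprM => h.
have := bern N => h1; have Nd0 : 0 <= N%:R * d by rewrite mulr_ge0 ?ler0n ?ltW.
have : (1 + N%:R * d) ^+ 2 <= ((1 + d) ^+ N) ^+ 2.
  by rewrite ler_sqr ?nnegrE //; lra.
move=> /le_trans /(_ h); rewrite -natr1 natrM => h2.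
have N0 : 0 < N%:R :> R.
  rewrite ltr0n lt0n; apply/eqP => N0; move: Nd; rewrite N0 mul0r; lra.
have : N%:R * (N%:R * d ^+ 2) <= N%:R * 2 by rewrite !expr2 in h2 *; nra.
by rewrite ler_pM2l //; lra.
Qed.

(** The binomial formula bounds the [k]-th power of [x (f + g)] by [k + 1]
    times the [k]-th power of the maximum, because binomial coefficients are
    integers. *)
Lemma mul_seminorm_ultrametric (R : realType) (B : comNzRingType) (x : B -> R) :
  mul_seminorm x -> (forall k, x k%:R <= 1) -> ultrametric x.
Proof.
move=> xP xnat f g; have x0 := mul_seminorm_ge0 xP.
apply: ler_of_exprn_linear => // [|k]; first by rewrite le_max x0.
rewrite -mul_seminormX // exprDn; apply: le_trans (mul_seminorm_sum xP _ _ _) _.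
rewrite mulr_natl -[X in _ *+ X]card_ord -sumr_const; apply: ler_sum => i _.
rewrite -mulr_natl !(mul_seminormM xP) !(mul_seminormX xP).
have [xM xfg] : 0 <= Num.max (x f) (x g) /\
    x f ^+ (k - i) * x g ^+ i <= Num.max (x f) (x g) ^+ k.
  split; first by rewrite le_max x0.
  rewrite -[X in _ <= _ ^+ X](subnK (leq_ord i)) exprD.
  apply: ler_pM; rewrite ?exprn_ge0 //.
    by apply: lerXn2r; rewrite ?nnegrE ?le_max ?x0 // lexx.
  by apply: lerXn2r; rewrite ?nnegrE ?le_max ?x0 // lexx orbT.
apply: le_trans xfg; apply: ler_piMl => //.
by rewrite mulr_ge0 ?exprn_ge0.
Qed.

Section UltrametricSum.
Variables (R : realType) (B : comNzRingType) (x : B -> R).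
Hypotheses (xP : mul_seminorm x) (xU : ultrametric x).

Lemma ultrametric_sum_le (I : Type) (r : seq I) (P : pred I) (F : I -> B) M :
  0 <= M -> (forall i, P i -> x (F i) <= M) -> x (\sum_(i <- r | P i) F i) <= M.
Proof.
move=> M0 FM; elim/big_rec: _ => [|i f Pi fM]; first by rewrite mul_seminorm0.
by apply: le_trans (xU _ _) _; rewrite ge_max fM FM.
Qed.

Lemma ultrametric_sum_lt (I : Type) (r : seq I) (P : pred I) (F : I -> B) M :
  0 < M -> (forall i, P i -> x (F i) < M) -> x (\sum_(i <- r | P i) F i) < M.
Proof.
move=> M0 FM; elim/big_rec: _ => [|i f Pi fM]; first by rewrite mul_seminorm0.
by apply: le_lt_trans (xU _ _) _; rewrite gt_max fM FM.
Qed.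

End UltrametricSum.

(** * Gauss norms *)

Section Gauss.
Variables (R : realType) (B : comNzRingType).
Implicit Types (x : B -> R) (p q : {poly B}) (r M : R).

(** The supremum norm on the closed disc of radius [r] centred at [0]. *)
Definition gauss x r p : R := \big[Num.max/0]_(k < size p) (x p`_k * r ^+ k).

Lemma gauss_ge0 x r p : 0 <= gauss x r p.
Proof. exact: bigmax_ge_id. Qed.

Lemma gauss_le x r p M : 0 <= M ->
  (forall k, x p`_k * r ^+ k <= M) -> gauss x r p <= M.
Proof. by move=> M0 pM; apply: bigmax_le. Qed.

Section Fixed.
Variable x : B -> R.
Hypotheses (xP : mul_seminorm x) (xU : ultrametric x).
Variable r : R.
Hypothesis r0 : 0 <= r.

Local Notation G := (gauss x r).

Lemma gauss_coef p k : x p`_k * r ^+ k <= G p.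
Proof.
have [kp|pk] := ltnP k (size p).
  exact: (le_bigmax _ (fun i : 'I__ => x p`_i * r ^+ i) (Ordinal kp)).
by rewrite nth_default // mul_seminorm0 // mul0r gauss_ge0.
Qed.

Lemma gaussC b : G b%:P = x b.
Proof.
apply/le_anti/andP; split.
  apply: gauss_le => [|k]; first exact: mul_seminorm_ge0.
  rewrite coefC; case: k => [|k]; first by rewrite mulr1.
  by rewrite mul_seminorm0 // mul0r mul_seminorm_ge0.
by have := gauss_coef b%:P 0; rewrite coefC mulr1.
Qed.

Lemma gauss_ultrametric : ultrametric G.
Proof.
move=> p q; apply: gauss_le => [|k]; first by rewrite le_max gauss_ge0.
rewrite coefD; apply: le_trans (_ : Num.max (x p`_k) (x q`_k) * r ^+ k <= _).
  by apply: ler_wpM2r; [exact: exprn_ge0|exact: xU].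
have [_|_] := leP (x p`_k) (x q`_k).
  by rewrite le_max gauss_coef orbT.
by rewrite le_max gauss_coef.
Qed.

Lemma gaussM_le p q : G (p * q) <= G p * G q.
Proof.
have GG : 0 <= G p * G q by rewrite mulr_ge0 ?gauss_ge0.
apply: gauss_le => // k; have [rk0|rk0] := eqVneq (r ^+ k) 0.
  by rewrite rk0 mulr0.
have rk : 0 < r ^+ k by rewrite lt_def rk0 exprn_ge0.
rewrite -ler_pdivlMr // coefM; apply: ultrametric_sum_le => // [|i _].
  by rewrite mulr_ge0 // invr_ge0 ltW.
rewrite ler_pdivlMr // mul_seminormM // -[X in r ^+ X](subnKC (leq_ord i)) exprD.
rewrite mulrACA; apply: ler_pM; rewrite ?gauss_coef // mulr_ge0 ?exprn_ge0 //.
  exact: mul_seminorm_ge0.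
exact: mul_seminorm_ge0.
Qed.

Lemma gauss_argmin p : 0 < G p -> exists k, x p`_k * r ^+ k = G p /\
  forall i, (i < k)%N -> x p`_i * r ^+ i < G p.
Proof.
move=> Gp0; have [|k /eqP Gk minG] := @ex_minnP (fun k => x p`_k * r ^+ k == G p).
  apply: contrapT => noG; move: (Gp0); rewrite ltNge => /negP; apply.
  have ltG k : x p`_k * r ^+ k < G p.
    by rewrite lt_def gauss_coef andbT eq_sym; apply/negP => Gk; apply: noG; exists k.
  have : G p < G p by apply: bigmax_lt.
  by rewrite ltxx.
exists k; split => // i ik; rewrite lt_def gauss_coef andbT eq_sym.
by apply/negP => /minG; rewrite leqNgt ik.
Qed.

(** Gauss lemma: for the least indices [i], [j] at which the two maxima are
    attained, the product of these two terms dominates all the other terms of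
    the coefficient of index [i + j]. *)
Lemma gaussM p q : G (p * q) = G p * G q.
Proof.
apply/le_anti; rewrite gaussM_le /=.
have [Gp0|Gp0] := eqVneq (G p) 0; first by rewrite Gp0 mul0r gauss_ge0.
have [Gq0|Gq0] := eqVneq (G q) 0; first by rewrite Gq0 mulr0 gauss_ge0.
have {}Gp0 : 0 < G p by rewrite lt_def Gp0 gauss_ge0.
have {}Gq0 : 0 < G q by rewrite lt_def Gq0 gauss_ge0.
have [[i [Gi mini]] [j [Gj minj]]] := (gauss_argmin Gp0, gauss_argmin Gq0).
have GG0 : 0 < G p * G q by exact: mulr_gt0.
have Gij : x (p`_i * q`_j) * r ^+ (i + j) = G p * G q.
  by rewrite -Gi -Gj mul_seminormM // exprD mulrACA.
have rij : 0 < r ^+ (i + j).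
  rewrite lt_def exprn_ge0 // andbT; apply/eqP => rij.
  by move: GG0; rewrite -Gij rij mulr0 ltxx.
have iij : (i < (i + j).+1)%N by rewrite ltnS leq_addr.
pose i0 := Ordinal iij.
pose rest := \sum_(k < (i + j).+1 | k != i0) p`_k * q`_(i + j - k).
have cE : (p * q)`_(i + j) = p`_i * q`_j + rest.
  by rewrite coefM (bigD1 i0) //= addKn.
have rest_lt : x rest < G p * G q / r ^+ (i + j).
  apply: ultrametric_sum_lt => // [|k ki]; first by rewrite divr_gt0.
  rewrite ltr_pdivlMr // mul_seminormM //.
  rewrite -[X in r ^+ X](subnKC (leq_ord k)) exprD mulrACA.
  have [xp0 xq0] : 0 <= x p`_k * r ^+ k /\
      0 <= x q`_(i + j - k) * r ^+ (i + j - k).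
    by split; rewrite mulr_ge0 ?exprn_ge0 // mul_seminorm_ge0.
  have [lt_ki|lt_ik|k_eq] := ltngtP k i.
  - apply: (@le_lt_trans _ _ (x p`_k * r ^+ k * G q)).
      by apply: ler_wpM2l => //; exact: gauss_coef.
    by rewrite ltr_pM2r // mini.
  - apply: (@le_lt_trans _ _ (G p * (x q`_(i + j - k) * r ^+ (i + j - k)))).
      by apply: ler_wpM2r => //; exact: gauss_coef.
    rewrite ltr_pM2l // minj //.
    by rewrite -(ltn_add2r k) (subnK (leq_ord k)) [X in (_ < X)%N]addnC ltn_add2r.
  - by move: ki; rewrite -val_eqE /= k_eq eqxx.
rewrite -Gij -ler_pdivlMr //; apply: le_trans (_ : x (p * q)`_(i + j) <= _); last first.
  by rewrite ler_pdivlMr // gauss_coef.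
have : x (p`_i * q`_j) <= Num.max (x (p * q)`_(i + j)) (x rest).
  have -> : p`_i * q`_j = (p * q)`_(i + j) + - rest by rewrite cE addrK.
  by apply: le_trans (xU _ _) _; rewrite mul_seminormN.
rewrite le_max => /orP[//|le_rest]; exfalso.
have := le_lt_trans le_rest rest_lt.
by rewrite ltr_pdivlMr // Gij ltxx.
Qed.

Lemma gauss_mul_seminorm : mul_seminorm G.
Proof.
split.
- exact: gauss_ge0.
- by rewrite gaussC mul_seminorm0.
- by rewrite gaussC mul_seminorm1.
- exact: gaussM.
- move=> p q; apply: le_trans (gauss_ultrametric p q) _.
  by rewrite ge_max lerDl lerDr !gauss_ge0.
Qed.

End Fixed.

Lemma gauss_radius0 x p : mul_seminorm x -> gauss x 0 p = x p.[0].
Proof.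
move=> xP; rewrite horner_coef0; apply/le_anti/andP; split.
  apply: gauss_le => [|[|k]]; first exact: mul_seminorm_ge0.
    by rewrite expr0 mulr1.
  by rewrite expr0n mulr0 mul_seminorm_ge0.
by have := gauss_coef xP 0 p 0; rewrite expr0 mulr1.
Qed.

(** The closed unit disc is stable under a translation by an element of norm
    at most 1. *)
Lemma gauss_translate x b p : mul_seminorm x -> ultrametric x -> x b <= 1 ->
  gauss x 1 (p \Po ('X + b%:P)) = gauss x 1 p.
Proof.
move=> xP xU xb.
have GP := gauss_mul_seminorm xP xU ler01; have GU := gauss_ultrametric xP xU ler01.
have GX : gauss x 1 'X <= 1.
  apply: gauss_le => // k; rewrite coefX expr1n mulr1.
  by case: eqP => _; rewrite ?mul_seminorm1 ?mul_seminorm0.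
have comp_le c q : x c <= 1 -> gauss x 1 (q \Po ('X + c%:P)) <= gauss x 1 q.
  move=> xc; rewrite comp_polyE; apply: ultrametric_sum_le => // [|i _].
    exact: gauss_ge0.
  rewrite -mul_polyC (mul_seminormM GP) gaussC //.
  have := gauss_coef xP 1 q i; rewrite expr1n mulr1; apply: le_trans.
  apply: ler_piMr; first exact: mul_seminorm_ge0.
  rewrite (mul_seminormX GP); apply: exprn_ile1; first exact: gauss_ge0.
  by apply: le_trans (GU _ _) _; rewrite ge_max GX gaussC.
apply/le_anti; rewrite comp_le //=.
have {1}-> : p = (p \Po ('X + b%:P)) \Po ('X + (- b)%:P).
  by rewrite -comp_polyA comp_polyD comp_polyX comp_polyC polyCN subrK comp_polyXr.
by apply: comp_le; rewrite mul_seminormN.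
Qed.

End Gauss.

(** * The spectrum of a Dedekind domain and its contraction *)

Lemma continuous_expr (R : realType) (T : topologicalType) (f : T -> R) (k : nat) t :
  {for t, continuous f} -> {for t, continuous (fun s => f s ^+ k)}.
Proof.
move=> fc; rewrite /prop_for /continuous_at; elim: k => [|k IHk].
  by under eq_fun do rewrite expr0; exact: cvg_cst.
by rewrite exprS; under eq_fun do rewrite exprS; exact: cvgM.
Qed.

Section Spectrum.
Variables (R : realType) (A : idomainType).
Implicit Types (y : A -> R) (p : {pred A}) (a b : A) (r : R).

Lemma spectrum_le1 y a : spectrum R A y -> y a <= 1.
Proof. by move=> [_ /(_ a) /le_trans]; apply; rewrite /trivial_norm lern1 leq_b1. Qed.

Lemma spectrum_ultrametric y : spectrum R A y -> ultrametric y.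
Proof.
move=> yS; apply: mul_seminorm_ultrametric; first by case: yS.
by move=> k; exact: spectrum_le1.
Qed.

Lemma trivial_norm_spectrum : spectrum R A (trivial_norm R A).
Proof. by split => //; exact: mul_seminorm_trivial_norm. Qed.

(** The centre of [y], that is, its image under the reduction map to the
    prime spectrum of [A]. *)
Definition center y : {pred A} := fun a => y a < 1.

Lemma centerE y a : (a \in center y) = (y a < 1). Proof. by []. Qed.

Lemma center_notin y a : spectrum R A y -> a \notin center y -> y a = 1.
Proof. by move=> yS; rewrite centerE -leNgt => ya; apply/le_anti; rewrite ya spectrum_le1. Qed.

Lemma center_ideal y : spectrum R A y -> idealr_closed (center y).
Proof.
move=> yS; have [yP _] := yS; split; rewrite ?centerE.
- by rewrite (mul_seminorm0 yP) ltr01.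
- by rewrite (mul_seminorm1 yP) ltxx.
- move=> a u v; rewrite !centerE => yu yv.
  apply: le_lt_trans (spectrum_ultrametric yS _ _) _.
  rewrite gt_max yv andbT (mul_seminormM yP); apply: le_lt_trans yu.
  by apply: ler_piMl; [exact: mul_seminorm_ge0|exact: spectrum_le1].
Qed.

Lemma center_prime y : spectrum R A y -> prime_idealr_closed (center y).
Proof.
move=> yS u v; rewrite -implyNb => uv; apply/implyP => /(center_notin yS) yu.
by move: uv; have [yP _] := yS; rewrite !centerE (mul_seminormM yP) yu mul1r.
Qed.

(** The uniformizer is chosen from the ideal [p] alone, so that points with
    the same centre share it. *)
Definition prime_uniformizer p : A := xget 0 [set x | uniformizer p x].

Definition prime_order p a : nat :=
  xget 0%N [set k | has_order p (prime_uniformizer p) a k].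

(** For [r = 0] and [p] nonzero this is the trivial norm of [A / p], for
    [r = 1] the trivial norm of [A]. *)
Definition padic_norm p r a : R :=
  if a == 0 then 0 else r ^+ prime_order p a.

Hypothesis dedA : dedekind_domain A.

Section Prime.
Variable p : {pred A}.
Hypotheses (idp : idealr_closed p) (pp : prime_idealr_closed p).

Local Notation x := (prime_uniformizer p).

Lemma prime_uniformizerP : uniformizer p x.
Proof.
exact: (@xgetPex _ 0 [set x | uniformizer p x]) (dedekind_uniformizer dedA idp pp).
Qed.

Lemma prime_orderP a : a != 0 -> has_order p x a (prime_order p a).
Proof.
move=> a0; have [noeA _ _] := dedA.
have ex := has_order_ex idp pp prime_uniformizerP noeA a0.
exact: (@xgetPex _ 0%N [set k | has_order p x a k]) ex.
Qed.

Lemma prime_orderE a k : a != 0 -> has_order p x a k -> prime_order p a = k.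
Proof.
move=> a0; apply: (has_order_inj idp pp prime_uniformizerP a0).
exact: prime_orderP.
Qed.

Lemma padic_norm0 r : padic_norm p r 0 = 0.
Proof. by rewrite /padic_norm eqxx. Qed.

Lemma padic_norm_neq0 r a : a != 0 -> padic_norm p r a = r ^+ prime_order p a.
Proof. by rewrite /padic_norm => /negbTE ->. Qed.

Lemma padic_norm_r1 : padic_norm p 1 = trivial_norm R A.
Proof.
apply/funext => a; rewrite /padic_norm /trivial_norm.
by case: eqP => // _; rewrite expr1n.
Qed.

Lemma padic_norm_homo r s a : 0 <= r -> r <= s -> padic_norm p r a <= padic_norm p s a.
Proof.
move=> r0 rs; rewrite /padic_norm; case: eqP => // _.
by apply: lerXn2r; rewrite ?nnegrE // (le_trans r0).
Qed.

Lemma padic_norm_spectrum r : 0 <= r <= 1 -> spectrum R A (padic_norm p r).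
Proof.
move=> /andP[r0 r1]; have xP := prime_uniformizerP; have [_ p1 _] := idp.
have N0 a : 0 <= padic_norm p r a.
  by rewrite /padic_norm; case: eqP => // _; exact: exprn_ge0.
split; last first.
  by move=> a; rewrite -padic_norm_r1; exact: padic_norm_homo.
split=> [//|||a b|a b].
- by rewrite padic_norm0.
- rewrite padic_norm_neq0 ?oner_neq0 // (@prime_orderE 1 0) ?oner_neq0 //.
  exact: has_order0.
- have [->|a0] := eqVneq a 0; first by rewrite !(mul0r, padic_norm0).
  have [->|b0] := eqVneq b 0; first by rewrite !(mulr0, padic_norm0).
  rewrite !padic_norm_neq0 ?mulf_neq0 // -exprD; congr (_ ^+ _).
  apply: prime_orderE; first exact: mulf_neq0.
  by apply: has_orderM => //; exact: prime_orderP.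
- have [->|a0] := eqVneq a 0; first by rewrite padic_norm0 !add0r.
  have [->|b0] := eqVneq b 0; first by rewrite padic_norm0 !addr0.
  have [ab0|ab0] := eqVneq (a + b) 0; first by rewrite ab0 padic_norm0 addr_ge0.
  wlog le_ab : a b a0 b0 ab0 / (prime_order p a <= prime_order p b)%N.
    move=> le_ab; have [/le_ab|/ltnW/le_ab] := leqP (prime_order p a) (prime_order p b).
      exact.
    by rewrite (addrC b a) (addrC (padic_norm p r b)); apply.
  apply: (@le_trans _ _ (padic_norm p r a)); last by rewrite lerDl.
  rewrite !padic_norm_neq0 //; apply: ler_wiXn2l => //.
  exact: (has_orderD idp pp xP ab0 le_ab (prime_orderP a0) (prime_orderP b0)
           (prime_orderP ab0)).
Qed.

End Prime.

(** Elements outside the centre have value 1, so in [s * a = u * x ^+ k] only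
    the power of the uniformizer contributes.  This is the classification of the
    points of the spectrum, in the manner of Ostrowski. *)
Lemma spectrum_padic_norm y : spectrum R A y ->
  y = padic_norm (center y) (y (prime_uniformizer (center y))).
Proof.
move=> yS; have [yP _] := yS; apply/funext => a.
have [->|a0] := eqVneq a 0; first by rewrite padic_norm0 (mul_seminorm0 yP).
rewrite padic_norm_neq0 //.
have [s [u [sp up sa]]] := prime_orderP (center_ideal yS) (center_prime yS) a0.
have := congr1 y sa; rewrite !(mul_seminormM yP) (mul_seminormX yP).
by rewrite (center_notin yS sp) (center_notin yS up) !mul1r.
Qed.

(** The homotopy contracting the spectrum: the parameter [q] pushes the branch
    of each prime towards the trivial norm, which is reached at [q = 1]. *)
Definition spectrum_flow y (q : R) : A -> R :=
  padic_norm (center y) (Num.max (y (prime_uniformizer (center y))) q).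

Lemma spectrum_flow_in y q : spectrum R A y -> q <= 1 ->
  spectrum R A (spectrum_flow y q).
Proof.
move=> yS q1; have [yP _] := yS.
apply: padic_norm_spectrum; [exact: center_ideal|exact: center_prime|].
by rewrite le_max ge_max q1 (mul_seminorm_ge0 yP) (spectrum_le1 _ yS).
Qed.

Lemma spectrum_flow0 y : spectrum R A y -> spectrum_flow y 0 = y.
Proof.
move=> yS; have [yP _] := yS.
rewrite /spectrum_flow max_l ?(mul_seminorm_ge0 yP) //.
by rewrite -spectrum_padic_norm.
Qed.

Lemma spectrum_flow1 y : spectrum R A y -> spectrum_flow y 1 = trivial_norm R A.
Proof.
move=> yS; rewrite /spectrum_flow max_r; last exact: spectrum_le1.
exact: padic_norm_r1.
Qed.

Lemma spectrum_flow_ge y q a : spectrum R A y -> y a <= spectrum_flow y q a.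
Proof.
move=> yS; have [yP _] := yS; rewrite {1}(spectrum_padic_norm yS).
by apply: padic_norm_homo; [exact: mul_seminorm_ge0|rewrite le_max lexx].
Qed.

(** A point other than the trivial norm has a maximal ideal as centre; as this
    ideal is finitely generated, the inequalities [y a < 1] on generators
    define a neighbourhood all of whose points have the same centre. *)
Lemma center_locally_constant (T : topologicalType) (y : T -> A -> R) (t : T) :
  (forall t, spectrum R A (y t)) -> (forall a, continuous (y ^~ a)) ->
  (exists2 a, a != 0 & y t a < 1) ->
  \forall s \near t, center (y s) = center (y t).
Proof.
move=> yS yc [a0 a0_neq0 ya0]; have [noeA _ dimA] := dedA.
have [_ maxp] := dimA _ (center_ideal (yS t)) (@center_prime _ (yS t))
  (ex_intro2 _ _ a0 ya0 a0_neq0).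
have [r [rp genp]] := noeA _ (center_ideal (yS t)).
have : \forall s \near t, {subset r <= center (y s)}.
  elim: r rp {genp} => [|a r IHr] rp; first exact: nearW.
  have {}IHr : \forall s \near t, {subset r <= center (y s)}.
    by apply: IHr => b br; apply: rp; rewrite inE br orbT.
  have ya : \forall s \near t, y s a < 1.
    exact: (@cvgr_lt _ _ _ _ (y ^~ a) _ (yc a t) _ (rp a (mem_head a r))).
  apply: filterS2 ya IHr => s ya rs b; rewrite inE => /predU1P[->|/rs//].
  by rewrite centerE.
apply: filterS => s rs.
have ts : {subset center (y t) <= center (y s)}.
  move=> b /genp[c ->]; apply: idealr_closed_sum => [|i]; first exact: center_ideal.
  by apply: idealr_closedMl; [exact: center_ideal|apply: rs; exact: mem_nth].
have st := maxp _ (center_ideal (yS s)) ts.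
by apply/funext => b; apply/idP/idP => [/st|/ts].
Qed.

Lemma spectrum_flow_continuous (T : topologicalType) (y : T -> A -> R)
    (q : T -> R) (a : A) :
  (forall t, spectrum R A (y t)) -> (forall a, continuous (y ^~ a)) ->
  continuous q -> (forall t, q t <= 1) ->
  continuous (fun t => spectrum_flow (y t) (q t) a).
Proof.
move=> yS yc qc q1 t.
have [a_eq0|a_neq0] := eqVneq a 0.
  rewrite a_eq0 /spectrum_flow; under eq_fun do rewrite padic_norm0.
  exact: cvg_cst.
(* Near a nontrivial point, centre, uniformizer and order are constant. *)
have [nontriv|triv] := pselect (exists2 b, b != 0 & y t b < 1).
  have near_center := center_locally_constant yS yc nontriv.
  pose x := prime_uniformizer (center (y t)).
  pose k := prime_order (center (y t)) a.
  have : {for t, continuous (fun s => Num.max (y s x) (q s) ^+ k)}.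
    by apply: continuous_expr; apply: continuous_max; [exact: yc|exact: qc].
  rewrite /prop_for /continuous_at {2}/spectrum_flow padic_norm_neq0 //.
  apply: cvg_trans; apply: near_eq_cvg.
  by apply: filterS near_center => s ps; rewrite /spectrum_flow ps padic_norm_neq0.
have yta : y t a = 1.
  apply: (center_notin (yS t)); apply/negP => yta; apply: triv; by exists a.
rewrite /continuous_at; have -> : spectrum_flow (y t) (q t) a = 1.
  apply/le_anti; rewrite (spectrum_le1 _ (spectrum_flow_in (yS t) (q1 t))) /=.
  by rewrite -yta spectrum_flow_ge.
apply: (@squeeze_cvgr _ _ _ _ (y ^~ a) (fun=> 1)).
- apply: nearW => s; rewrite spectrum_flow_ge //=.
  by rewrite (spectrum_le1 _ (spectrum_flow_in (yS s) (q1 s))).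
- by rewrite -yta; exact: yc.
- exact: cvg_cst.
Qed.

End Spectrum.

(** * Homotopies in spaces of functions *)

Section Lattice.
Variables (R : realType) (T : topologicalType) (f g : T -> R).
Hypotheses (fc : continuous f) (gc : continuous g).

Lemma continuous_fun_min : continuous (fun t => Num.min (f t) (g t)).
Proof. by move=> t; exact: (continuous_min (fc (x := t)) (gc (x := t))). Qed.

Lemma continuous_fun_max : continuous (fun t => Num.max (f t) (g t)).
Proof. by move=> t; exact: (continuous_max (fc (x := t)) (gc (x := t))). Qed.

End Lattice.

Section HomotopicIn.
Variables (R : realType) (T : topologicalType) (B : Type) (P : set (B -> R)).
Implicit Types u v w : T -> B -> R.

(** Homotopies in the subspace [P] of the space of functions [B -> R].  They
    are extended to all real times, so that no restriction to the unit interval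
    is needed when they are reparametrized or glued. *)
Definition homotopic_in u v : Prop :=
  exists h : T * R -> B -> R,
    [/\ forall b, continuous (h ^~ b), forall z, P (h z),
        forall t, h (t, 0) = u t & forall t, h (t, 1) = v t].

Lemma continuous_reparam (h : T * R -> B -> R) (r : T * R -> R) b :
  continuous (h ^~ b) -> continuous r ->
  continuous (fun z : T * R => h (z.1, r z) b).
Proof.
move=> hb rc z.
apply: (@continuous_comp _ _ _ (fun z : T * R => (z.1, r z)) (h ^~ b)); last exact: hb.
by apply: (@cvg_pair _ _ _ _ (nbhs z.1) (nbhs (r z))); [exact: cvg_fst|exact: rc].
Qed.

Lemma homotopic_in_sym u v : homotopic_in u v -> homotopic_in v u.
Proof.
move=> [h [hc hP h0 h1]]; exists (fun z => h (z.1, 1 - z.2)); split => //=.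
- move=> b; apply: continuous_reparam => // z.
  by apply: cvgB; [exact: cvg_cst|exact: cvg_snd].
- by move=> t; rewrite subr0.
- by move=> t; rewrite subrr.
Qed.

(** The values are real numbers, so the concatenation can be written as a sum
    whose continuity needs no gluing. *)
Lemma homotopic_in_trans v u w :
  homotopic_in u v -> homotopic_in v w -> homotopic_in u w.
Proof.
move=> [h [hc hP h0 h1]] [k [kc kP k0 k1]].
pose g (z : T * R) b := h (z.1, Num.min (2 * z.2) 1) b +
  k (z.1, Num.max (2 * z.2 - 1) 0) b - v z.1 b.
have gh (t : T) (s : R) : s <= 2^-1 -> g (t, s) = h (t, Num.min (2 * s) 1).
  move=> s2; apply/funext => b; rewrite /g /= (max_r (_ : 2 * s - 1 <= 0)) ?k0 ?addrK //.
  by lra.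
have gk (t : T) (s : R) : 2^-1 <= s -> g (t, s) = k (t, Num.max (2 * s - 1) 0).
  move=> s2; apply/funext => b; rewrite /g /= (min_r (_ : 1 <= 2 * s)) ?h1; last lra.
  by rewrite addrAC subrr add0r.
have c2 : continuous (fun z : T * R => 2 * z.2).
  by move=> z; apply: cvgM; [exact: cvg_cst|exact: cvg_snd].
exists g; split.
- move=> b z; apply: cvgB; first apply: cvgD.
  + apply: continuous_reparam => //; apply: continuous_fun_min => //.
    by move=> y; exact: cvg_cst.
  + apply: continuous_reparam => //; apply: continuous_fun_max => y.
      by apply: cvgB; [exact: c2|exact: cvg_cst].
    exact: cvg_cst.
  + have -> : (fun z : T * R => v z.1 b) = (fun z => h (z.1, 1) b).
      by apply/funext => y; rewrite h1.
    by rewrite -h1; apply: (@continuous_reparam h (fun=> 1)) => // y; exact: cvg_cst.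
- by move=> [t s]; have [/gh ->|/ltW/gk ->] := leP s 2^-1.
- by move=> t; rewrite gh ?invr_ge0 // mulr0 min_l ?ler01 // h0.
- move=> t; rewrite gk; last by lra.
  by rewrite max_l; [rewrite mulr1 (_ : 2 - 1 = 1) ?k1 //; ring|lra].
Qed.

End HomotopicIn.

(** To be applied to the inclusion of a subspace [Y] into a space of functions
    with the topology of pointwise convergence. *)
Lemma homotopic_of_in (R : realType) (B : Type) (X Y : topologicalType)
    (i : Y -> B -> R) (P : set (B -> R)) (f g : X -> Y) :
  injective i -> (forall x, P x -> exists y, i y = x) ->
  (forall (T : topologicalType) (h : T -> Y),
     (forall b, continuous (fun t => i (h t) b)) -> continuous h) ->
  homotopic_in P (i \o f) (i \o g) -> homotopic R f g.
Proof.
move=> i_inj i_surj i_cont [h [hc hP h0 h1]].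
have /choice[H HP] z : exists y, i y = h z by exact: i_surj.
exists H; split.
- apply: continuous_subspaceT; apply: i_cont => b.
  by under eq_fun do rewrite HP; exact: hc.
- by move=> x; apply: i_inj; rewrite HP h0.
- by move=> x; apply: i_inj; rewrite HP h1.
Qed.

Section PointwiseSubspace.
Variables (R : realType) (B : choiceType) (S : set {ptws B -> R}).

Lemma continuous_into_ptws_sub (T : topologicalType) (h : T -> S) :
  (forall b, continuous (fun t => (\val (h t) : B -> R) b)) -> continuous h.
Proof.
move=> hc; apply: continuous_comp_initial => t; apply/cvg_sup => b.
exact: (@continuous_comp_initial _ _ _ (fun f : B -> R => f b)
  (fun t => \val (h t)) (hc b)).
Qed.

Lemma eval_continuous (b : B) : continuous (fun s : S => (\val s : B -> R) b).
Proof.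
move=> s; apply: (@continuous_comp _ _ _ (\val : S -> {ptws B -> R})
  (fun f : {ptws B -> R} => f b)); first exact: initial_continuous.
exact: (@proj_continuous B (fun=> R) b).
Qed.

End PointwiseSubspace.

Section GaussContinuity.
Variables (R : realType) (T : topologicalType).

Lemma continuous_bigmax (I : Type) (s : seq I) (F : I -> T -> R) :
  (forall i, continuous (F i)) ->
  continuous (fun t => \big[Num.max/0]_(i <- s) F i t).
Proof.
move=> Fc; elim: s => [|i s IHs] t.
  by under eq_fun do rewrite big_nil; exact: cvg_cst.
rewrite /continuous_at big_cons; under eq_fun do rewrite big_cons.
by apply: continuous_fun_max t; [exact: Fc|exact: IHs].
Qed.

Lemma gauss_continuous (B : comNzRingType) (u : T -> B -> R) (r : T -> R)
    (p : {poly B}) : (forall b, continuous (u ^~ b)) -> continuous r ->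
  continuous (fun t => gauss (u t) (r t) p).
Proof.
move=> uc rc; apply: continuous_bigmax => k t.
by apply: cvgM; [exact: uc|exact: continuous_expr (rc t)].
Qed.

End GaussContinuity.

Lemma mul_seminorm_comp (R : realType) (B C : nzRingType) (f : {rmorphism B -> C})
    (x : C -> R) : mul_seminorm x -> mul_seminorm (x \o f).
Proof.
move=> [x_ge0 x0 x1 xM xD]; split => [b|||a b|a b] /=.
- exact: x_ge0.
- by rewrite rmorph0.
- by rewrite rmorph1.
- by rewrite rmorphM.
- by rewrite rmorphD.
Qed.

(** * Contraction of affine space *)

Section Dilation.
Variables (R : realType) (A : idomainType) (n : nat).
Implicit Types (f : {mpoly A[n]}) (x : {mpoly A[n]} -> R).

(** [f (T_1, .., T_n)] is mapped to [f (X T_1, .., X T_n)]: the action of the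
    multiplicative monoid of the affine line on affine space. *)
Definition dilate : {mpoly A[n]} -> {poly {mpoly A[n]}} :=
  mmap (polyC \o @mpolyC n A) (fun i => (mpolyX A (mnm1 i))%:P * 'X).

HB.instance Definition _ := GRing.RMorphism.on dilate.

Definition origin : {mpoly A[n]} -> A := meval (fun=> 0).

HB.instance Definition _ := GRing.RMorphism.on origin.

Lemma dilateC a : dilate (mpolyC n a) = (mpolyC n a)%:P.
Proof. exact: mmapC. Qed.

Lemma originC a : origin (mpolyC n a) = a.
Proof. exact: mevalC. Qed.

Lemma horner_dilate f (b : {mpoly A[n]}) :
  (dilate f).[b] = mmap (@mpolyC n A) (fun i => mpolyX A (mnm1 i) * b) f.
Proof.
rewrite /dilate /mmap horner_sum; apply: eq_bigr => m _.
rewrite hornerM hornerC /mmap1 horner_prod; congr (_ * _).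
by apply: eq_bigr => i _; rewrite horner_exp hornerM hornerC hornerX.
Qed.

Lemma dilate1 f : (dilate f).[1] = f.
Proof.
rewrite horner_dilate {2}(mpolyE f); apply: eq_bigr => m _.
rewrite -mul_mpolyC -mmap1_id; congr (_ * _).
by apply: mmap1_eq => i; rewrite mulr1.
Qed.

Lemma dilate0 f : (dilate f).[0] = mpolyC n (origin f).
Proof.
rewrite horner_dilate /origin /meval /mmap rmorph_sum; apply: eq_bigr => m _.
rewrite rmorphM /mmap1 rmorph_prod; congr (_ * _).
by apply: eq_bigr => i _; rewrite mulr0 rmorphXn /= mpolyC0.
Qed.

(** The analytification of affine space restricted to a subset [W] of the
    spectrum. *)
Definition affine_space_over (W : set (A -> R)) : set ({mpoly A[n]} -> R) :=
  [set x | mul_seminorm x /\ W (x \o @mpolyC n A)].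

Lemma analytic_affine_spaceE :
  analytic_affine_space R A n = affine_space_over (spectrum R A).
Proof.
apply/seteqP; split=> x [xP xA]; split => //; last by case: xA.
by split => //; exact: mul_seminorm_comp.
Qed.

Section Contraction.
Variables (W : set (A -> R)) (T : topologicalType) (u : T -> {mpoly A[n]} -> R).
Hypothesis W_spectrum : W `<=` spectrum R A.
Hypothesis uW : forall t, affine_space_over W (u t).
Hypothesis uc : forall f, continuous (u ^~ f).

Let uP t : mul_seminorm (u t). Proof. by case: (uW t). Qed.

Let uU t : ultrametric (u t).
Proof.
apply: mul_seminorm_ultrametric => // k.
have [_ /W_spectrum uS] := uW t.
by have := spectrum_le1 k%:R uS; rewrite /= rmorph_nat.
Qed.

(** The values of the analytic function [c |-> f (c T)] on a disc: the disc
    centred at [1] grows from the point [1] to the closed unit disc, which is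
    also centred at [0] and then shrinks to the origin.  The norms on these
    discs form a path from the point [u t] to its image in the zero section;
    constants have constant norm along the path, so that it stays over [W]. *)
Lemma contraction_to_zero_section :
  homotopic_in (affine_space_over W) u (fun t f => u t (mpolyC n (origin f))).
Proof.
have absc : continuous (fun z : T * R => `|z.2|).
  by move=> z; apply: cvg_norm; exact: cvg_snd.
have fstc f : continuous (fun z : T * R => u z.1 f).
  by move=> z; apply: (@continuous_comp _ _ _ fst (u ^~ f)); [exact: cvg_fst|exact: uc].
apply: (@homotopic_in_trans _ _ _ _ (fun t f => gauss (u t) 1 (dilate f))).
  exists (fun z f => gauss (u z.1) `|z.2| (dilate f \Po ('X + 1%:P))); split.
  - by move=> f; apply: gauss_continuous.
  - move=> z; split.
      have GP := gauss_mul_seminorm (uP z.1) (@uU z.1) (normr_ge0 z.2).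
      exact: (mul_seminorm_comp dilate
        (mul_seminorm_comp (comp_poly ('X + 1%:P)) GP)).
    have [_] := uW z.1; congr W; apply/funext => a /=.
    by rewrite dilateC comp_polyC gaussC.
  - move=> t /=; apply/funext => f; rewrite normr0 gauss_radius0 //.
    by rewrite horner_comp hornerD hornerX hornerC add0r dilate1.
  - move=> t /=; apply/funext => f; rewrite normr1 gauss_translate //.
    by rewrite mul_seminorm1.
exists (fun z f => gauss (u z.1) `|1 - z.2| (dilate f)); split.
- move=> f; apply: gauss_continuous => // z; apply: cvg_norm.
  by apply: cvgB; [exact: cvg_cst|exact: cvg_snd].
- move=> z; split.
    have GP := gauss_mul_seminorm (uP z.1) (@uU z.1) (normr_ge0 (1 - z.2)).
    exact: (mul_seminorm_comp dilate GP).
  have [_] := uW z.1; congr W; apply/funext => a /=.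
  by rewrite dilateC gaussC.
- by move=> t /=; rewrite subr0 normr1.
- by move=> t /=; apply/funext => f; rewrite subrr normr0 gauss_radius0 // dilate0.
Qed.

End Contraction.

(** The point over the trivial norm to which everything contracts. *)
Definition trivial_origin : {mpoly A[n]} -> R := trivial_norm R A \o origin.

Lemma trivial_fibre_contractible (T : topologicalType) (u : T -> {mpoly A[n]} -> R) :
  (forall t, affine_space_over [set trivial_norm R A] (u t)) ->
  (forall f, continuous (u ^~ f)) ->
  homotopic_in (affine_space_over [set trivial_norm R A]) u (fun=> trivial_origin).
Proof.
move=> uW uc; have -> : (fun=> trivial_origin) = fun t f => u t (mpolyC n (origin f)).
  apply/funext => t; apply/funext => f; have [_ ut] := uW t.
  by rewrite /trivial_origin -ut.
apply: contraction_to_zero_section => // _ ->; exact: trivial_norm_spectrum.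
Qed.

(** Once in the zero section, which is a copy of the spectrum, the points are
    moved by the flow of the spectrum. *)
Lemma analytic_affine_space_contractible (T : topologicalType)
    (u : T -> {mpoly A[n]} -> R) : dedekind_domain A ->
  (forall t, affine_space_over (spectrum R A) (u t)) ->
  (forall f, continuous (u ^~ f)) ->
  homotopic_in (affine_space_over (spectrum R A)) u (fun=> trivial_origin).
Proof.
move=> dedA uW uc.
apply: homotopic_in_trans (contraction_to_zero_section _ uW uc) _ => //.
pose y t : A -> R := u t \o @mpolyC n A.
have yS t : spectrum R A (y t) by case: (uW t).
pose q (z : T * R) := Num.min `|z.2| 1.
have q1 z : q z <= 1 by rewrite ge_min lexx orbT.
have qS z := spectrum_flow_in dedA (yS z.1) (q1 z).
exists (fun z => spectrum_flow (y z.1) (q z) \o origin); split.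
- move=> f; apply: (@spectrum_flow_continuous _ _ dedA _ (y \o fst)) => //.
  + by move=> z; exact: yS.
  + move=> a z; apply: (@continuous_comp _ _ _ fst (u ^~ (mpolyC n a))).
      exact: cvg_fst.
    exact: uc.
  + apply: continuous_fun_min => z; last exact: cvg_cst.
    by apply: cvg_norm; exact: cvg_snd.
- move=> z; split; first by apply: mul_seminorm_comp; case: (qS z).
  rewrite (_ : _ \o _ = spectrum_flow (y z.1) (q z)) //.
  by apply/funext => a /=; rewrite originC.
- move=> t /=; rewrite /q normr0 min_l ?ler01 // spectrum_flow0 //.
- by move=> t; rewrite /q /= normr1 minxx spectrum_flow1.
Qed.

End Dilation.

Arguments trivial_origin : clear implicits.

Theorem mainTheorem6 (R : realType) (A : idomainType) (n : nat) :
  dedekind_domain A -> (1 <= n)%N ->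
  homotopy_equivalence R
    (set_val : trivial_fibre R A n -> analytic_affine_space R A n).
Proof.
move=> dedA _.
pose i (y : analytic_affine_space R A n) : {mpoly A[n]} -> R := \val y.
pose j (x : trivial_fibre R A n) := i (\val x).
have iP y : affine_space_over (spectrum R A) (i y).
  by rewrite -analytic_affine_spaceE; exact: set_mem (valP y).
have i_inj : injective i by move=> y y' /val_inj.
have i_surj x : affine_space_over (spectrum R A) x -> exists y, i y = x.
  by rewrite -analytic_affine_spaceE => /mem_set xP; exists (exist _ x xP).
have jP x : affine_space_over [set trivial_norm R A] (j x).
  have /set_mem/(congr1 \val) jx := valP x; split => //.
  by case: (iP (\val x)).
have j_inj : injective j by move=> x x' /i_inj /val_inj.
have j_surj x : affine_space_over [set trivial_norm R A] x -> exists y, j y = x.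
  move=> [xP xA]; have [|y yx] := i_surj x.
    by split => //; rewrite xA; exact: trivial_norm_spectrum.
  have yF : y \in trivial_fibre R A n.
    by apply/mem_set/val_inj; rewrite /= -[RHS]xA -yx.
  by exists (exist _ y yF).
have i_cont f : continuous (i ^~ f) by exact: eval_continuous.
have into_i (T : topologicalType) (h : T -> analytic_affine_space R A n) :
    (forall f, continuous (fun t => i (h t) f)) -> continuous h.
  exact: continuous_into_ptws_sub.
have val_cont : continuous
    (set_val : trivial_fibre R A n -> analytic_affine_space R A n).
  exact: initial_continuous.
have j_cont f : continuous (j ^~ f).
  move=> x.
  exact: (@continuous_comp _ _ _ set_val (i ^~ f) x (val_cont x) (@i_cont f _)).
have into_j (T : topologicalType) (h : T -> trivial_fibre R A n) :
    (forall f, continuous (fun t => j (h t) f)) -> continuous h.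
  by move=> hc; apply: continuous_comp_initial; exact: into_i.
have [x0 jx0] : exists x0, j x0 = trivial_origin R A n.
  apply: j_surj; split.
    apply: mul_seminorm_comp; exact: mul_seminorm_trivial_norm.
  by apply/funext => a; rewrite /trivial_origin /= originC.
split => //; exists (fun=> x0); split.
- exact: cst_continuous.
- apply: (homotopic_of_in j_inj j_surj into_j); apply: homotopic_in_sym.
  rewrite [X in homotopic_in _ _ X](_ : _ = fun=> trivial_origin R A n); last first.
    by apply/funext => x; rewrite -jx0.
  exact: trivial_fibre_contractible.
- apply: (homotopic_of_in i_inj i_surj into_i); apply: homotopic_in_sym.
  rewrite [X in homotopic_in _ _ X](_ : _ = fun=> trivial_origin R A n); last first.
    by apply/funext => y; rewrite -jx0.
  exact: analytic_affine_space_contractible.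
Qed.
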